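(* Let $p$ be an odd prime, write $\mathbb{F}_p=\{0,a_1,\ldots,a_{p-1}\}$ for the finite field with $p$ elements, and let $\chi=\left(\frac{\cdot}{p}\right)$ be the quadratic character of $\mathbb{F}_p$. Let $$S_p=\left[(a_i^2+a_ia_j+a_j^2)\,\chi(a_i^2+a_ia_j+a_j^2)\right]_{1\le i,j\le p-1},$$ a $(p-1)\times(p-1)$ matrix over $\mathbb{F}_p$. Suppose $p\nmid\det S_p$ (that is, $\det S_p\neq 0$ in $\mathbb{F}_p$). Then $$\left(\frac{\det S_p}{p}\right)=\left(\frac{T_{\frac{p+1}{2}}}{p}\right).$$
   Context: The elements $a_1,\ldots,a_{p-1}$ are the nonzero elements of $\mathbb{F}_p$, listed without repetition. $\left(\frac{\cdot}{p}\right)$ is the Legendre symbol, which depends only on the residue class modulo $p$ and so is also defined on elements of $\mathbb{F}_p$; thus $\chi(0)=0$, $\chi(x)=1$ if $x$ is a nonzero square in $\mathbb{F}_p$, and $\chi(x)=-1$ otherwise, and in the entries of $S_p$ these values are regarded as elements of $\mathbb{F}_p$. For a non-negative integer $n$, the central trinomial coefficient $T_n$ is the coefficient of $x^n$ in $(x^2+x+1)^n\in\mathbb{Z}[x]$, equivalently the constant term of $(x+1+x^{-1})^n$.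
   Formalization: The prime p = 3 is excluded, since the claim fails there: S_3 = [[0,1],[1,0]] has determinant -1, with Legendre symbol -1, whereas T_2 = 3 has Legendre symbol 0 modulo 3. *)

(* Defs.v *)
From HB Require Import structures.
From mathcomp Require Import all_boot all_order all_algebra.

Set Implicit Arguments.
Unset Strict Implicit.
Unset Printing Implicit Defensive.

Import GRing.Theory.
Local Open Scope ring_scope.

(* Integer-valued, so that it can be compared across fields; it is cast into
   the field with %:~R where its values are used as field elements. *)
Definition quad_char (F : finFieldType) (x : F) : int :=
  if x == 0 then 0 else if [exists y : F, x == y ^+ 2] then 1 else -1.

(* The Legendre symbol (m / p). Meaningful for p an odd prime only: for other
   p, 'F_p is the prime field of the smallest prime divisor of p. *)
Definition legendre (m : int) (p : nat) : int := quad_char (m%:~R : 'F_p).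

Definition central_trinomial (n : nat) : int :=
  (('X^2 + 'X + 1 : {poly int}) ^+ n)`_n.

Definition S_mx (p : nat) (a : 'I_p.-1 -> 'F_p) : 'M['F_p]_p.-1 :=
  \matrix_(i, j) ((a i ^+ 2 + a i * a j + a j ^+ 2) *
                  (quad_char (a i ^+ 2 + a i * a j + a j ^+ 2))%:~R).

(* Main.v *)
Require Import Defs.
From HB Require Import structures.
From mathcomp Require Import all_boot all_order all_algebra.
From mathcomp Require Import cyclic finfield zify ring.

Set Implicit Arguments.
Unset Strict Implicit.
Unset Printing Implicit Defensive.

Import GRing.Theory.
Local Open Scope ring_scope.

(* By Euler's criterion the entries of S_p are (a_i^2 + a_i a_j + a_j^2)^m with
   m = (p + 1) / 2.  Expanding, and reducing exponents modulo p - 1, the (i, j)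
   entry is a_j^2 times the sum over k < p - 1 of d_k (a_i / a_j)^k, so S_p
   factors through a diagonal matrix between two Vandermonde-like matrices which
   are inverse to each other up to the factor p - 1.  Hence det S_p is a square
   times the product of the d_k.  Here d_k is the k-th coefficient c_k of
   (x^2 + x + 1)^m, except that d_0 = c_0 + c_(p-1), d_1 = c_1 + c_p and
   d_2 = c_2 + c_(p+1).  As c_k = c_(p+1-k), the d_k are equal in pairs, apart
   from d_1 = 2 c_1 = p + 1 = 1 and d_m = T_m. *)

(** For a nonsquare, write [x] as a power of a primitive root [g]. The exponent is odd, and [g ^+ n]
    is -1, since it squares to 1 but [g] has order 2n. *)
Lemma euler_criterion (F : finFieldType) (x : F) :
  odd #|F| -> (quad_char x)%:~R = x ^+ (#|F|.-1./2) :> F.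
Proof.
move=> oddF; set n := #|F|.-1./2.
have cardF_gt1 : (1 < #|F|)%N by exact: finNzRing_gt1.
have def_n : #|F|.-1 = (n * 2)%N by rewrite /n; lia.
have n_gt0 : (0 < n)%N by lia.
have fermat (y : F) : y != 0 -> y ^+ #|F|.-1 = 1.
  move=> y0; apply: (mulfI y0).
  by rewrite -exprS mulr1 prednK ?expf_card //; lia.
rewrite /quad_char; case: eqVneq => [->|x0].
  by rewrite expr0n eqn0Ngt n_gt0.
case: existsP => [[y /eqP def_x]|nsq].
  rewrite def_x -exprM mulnC -def_n fermat //.
  by apply: contraNneq x0 => y0; rewrite def_x y0 expr0n.
pose rs := enum [pred y : F | y != 0].
have size_rs : size rs = #|F|.-1.
  by rewrite -cardE (cardC1 (0 : F)).
have /hasP[g _ g_prim] : has #|F|.-1.-primitive_root rs.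
  apply: has_prim_root; rewrite ?size_rs ?enum_uniq //; first by lia.
  apply/allP => y; rewrite mem_enum inE => y0.
  by rewrite unity_rootE fermat.
have [k def_x] := prim_rootP g_prim (fermat x x0).
have gn : g ^+ n = -1.
  have : (g ^+ n) ^+ 2 == 1 by rewrite -exprM -def_n prim_expr_order.
  rewrite sqrf_eq1 => /orP[|/eqP //]; rewrite -(prim_order_dvd g_prim) def_n.
  by move/(dvdn_leq n_gt0); lia.
have odd_k : odd k.
  apply: contra_notT nsq => even_k; exists (g ^+ k./2).
  by rewrite def_x -exprM; apply/eqP; congr (_ ^+ _); lia.
by rewrite def_x exprAC gn -signr_odd odd_k expr1 mulrN1z.
Qed.

Lemma quad_char_sqrM (F : finFieldType) (s t : F) :
  s != 0 -> quad_char (s ^+ 2 * t) = quad_char t.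
Proof.
move=> s0; rewrite /quad_char mulf_eq0 expf_eq0 /= (negPf s0) /=.
case: (t == 0) => //; congr (if _ then _ else _).
apply/existsP/existsP => -[y /eqP def_y].
  exists (y / s); apply/eqP; apply: (mulfI (expf_neq0 2 s0)).
  by rewrite def_y -exprMn mulrCA divff // mulr1.
by exists (s * y); rewrite def_y exprMn.
Qed.

Lemma det_ratio_mx (F : fieldType) (N : nat) (a : 'I_N -> F) (f : nat -> F) :
    injective a -> (forall i, a i != 0) -> (forall i, a i ^+ N = 1) ->
  \det (\matrix_(i, j) \sum_(k < N) f k * (a i / a j) ^+ k)
    = N%:R ^+ N * \prod_(k < N) f k.
Proof.
move=> a_inj a0 aN.
pose V : 'M[F]_N := \matrix_(i, k) a i ^+ k.
pose W : 'M[F]_N := \matrix_(k, j) (a j)^-1 ^+ k.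
have VW : V *m W = N%:R%:M.
  apply/matrixP => i j; rewrite !mxE.
  under eq_bigr => k _ do rewrite !mxE -exprMn.
  case: eqVneq => [->|neq_ij].
    under eq_bigr => k _ do rewrite divff // expr1n.
    by rewrite sumr_const card_ord mulr1n.
  (* Off the diagonal the ratio r is an N-th root of unity other than 1, so its geometric sum
     vanishes: r - 1 times that sum is r^N - 1 = 0. *)
  have ratio_neq1 : a i / a j - 1 != 0.
    rewrite subr_eq0; apply: contra_neq neq_ij => /divr1_eq; exact: a_inj.
  apply: (mulfI ratio_neq1).
  by rewrite -subrX1 exprMn exprVn !aN divff ?oner_neq0 // subrr mulr0n mulr0.
have -> : \matrix_(i, j) (\sum_(k < N) f k * (a i / a j) ^+ k)
    = V *m diag_mx (\row_k f k) *m W.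
  apply/matrixP => i j; rewrite mul_mx_diag !mxE; apply: eq_bigr => k _.
  by rewrite !mxE exprMn mulrCA mulrA.
(* The determinants of [V] and [W] enter only through their product, that of [V *m W]. *)
rewrite !det_mulmx mulrAC -det_mulmx VW det_scalar det_diag.
by congr (_ * _); apply: eq_bigr => k _; rewrite mxE.
Qed.

Definition trinomial (R : comNzRingType) (m : nat) : {poly R} :=
  ('X^2 + 'X + 1) ^+ m.

Section Trinomial.

Variable R : comNzRingType.
Implicit Types m i j : nat.

(** The conditionals stand for zero coefficients at negative indices, where subtraction on [nat]
    would truncate. *)
Lemma coef_trinomialS m i :
  (trinomial R m.+1)`_i = (if (i < 2)%N then 0 else (trinomial R m)`_(i - 2))
    + (if i == 0%N then 0 else (trinomial R m)`_i.-1) + (trinomial R m)`_i.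
Proof. by rewrite {1}/trinomial exprSr !mulrDr mulr1 !coefD coefMXn coefMX. Qed.

Lemma trinomial_coef0 m : (trinomial R m)`_0 = 1.
Proof.
elim: m => [|m IHm]; first by rewrite /trinomial expr0 coef1.
by rewrite coef_trinomialS IHm /= !add0r.
Qed.

Lemma trinomial_coef1 m : (trinomial R m)`_1 = m%:R.
Proof.
elim: m => [|m IHm]; first by rewrite /trinomial expr0 coef1.
by rewrite coef_trinomialS IHm /= trinomial_coef0 add0r -natr1 addrC.
Qed.

Lemma trinomial_coef_gt m i : (2 * m < i)%N -> (trinomial R m)`_i = 0.
Proof.
elim: m i => [|m IHm] i lt_i.
  by rewrite /trinomial expr0 coef1; case: i lt_i.
rewrite coef_trinomialS !IHm; try lia.
by rewrite !if_same !addr0.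
Qed.

(** The three-term recurrence is itself symmetric. The cases i = 0 and i = 1 are separate because
    there negative indices face indices above 2m. *)
Lemma trinomial_coef_sym m i j :
  (i + j = 2 * m)%N -> (trinomial R m)`_i = (trinomial R m)`_j.
Proof.
elim: m i j => [|m IHm] i j; first by case: i j => [|i] [|j].
wlog le_ij : i j / (i <= j)%N.
  move=> wlog_ij def_m; case: (leqP i j) => [/wlog_ij|/ltnW/wlog_ij]; first exact.
  by move=> ->; rewrite // addnC.
case: i le_ij => [|[|i]] le_ij def_m.
- have [k def_j] : exists k, j = k.+2 by exists (j - 2)%N; lia.
  rewrite def_j (coef_trinomialS m 0) (coef_trinomialS m k.+2) /= subn2 /=.
  have -> : k = (2 * m)%N by lia.
  rewrite (IHm 0%N (2 * m)%N) // (@trinomial_coef_gt m (2 * m).+1) //.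
  by rewrite (@trinomial_coef_gt m (2 * m).+2) // !addr0 !add0r.
(* The value j = 1 occurs only for m = 0, where both indices coincide. *)
- case: (eqVneq j 1%N) => [->//|j_neq1].
  have [k def_j] : exists k, j = k.+2 by exists (j - 2)%N; lia.
  have km : (k.+1 = 2 * m)%N by lia.
  rewrite def_j (coef_trinomialS m 1) (coef_trinomialS m k.+2) /= subn2 /=.
  rewrite (IHm 1%N k) ?(IHm 0%N k.+1) ?add0n ?add1n //.
  rewrite (@trinomial_coef_gt m k.+2); last by rewrite -km.
  by rewrite add0r addr0 addrC.
- have [k def_j] : exists k, j = k.+2 by exists (j - 2)%N; lia.
  rewrite def_j (coef_trinomialS m i.+2) (coef_trinomialS m k.+2) /= !subn2 /=.
  rewrite (IHm i.+2 k) ?(IHm i.+1 k.+1) ?(IHm i k.+2); [|lia..].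
  by rewrite addrAC [RHS]addrC addrA addrAC.
Qed.

End Trinomial.

Lemma trinomial_homog (F : fieldType) (m : nat) (x y : F) : y != 0 ->
  (x ^+ 2 + x * y + y ^+ 2) ^+ m
    = y ^+ (2 * m) * \sum_(k < (2 * m).+1) (trinomial F m)`_k * (x / y) ^+ k.
Proof.
move=> y0; have size_tri : (size (trinomial F m) <= (2 * m).+1)%N.
  by apply/leq_sizeP => j; exact: trinomial_coef_gt.
rewrite -(horner_coef_wide _ size_tri) /trinomial horner_exp !hornerE.
by rewrite exprM -exprMn; congr (_ ^+ _); field.
Qed.

(** Index 0 pairs with 2, and k with 2n + 2 - k. This leaves 1 and the fixed point n + 1; the
    witness takes one factor from each pair. *)
Lemma prod_sym_sqr (R : comNzRingType) (d : nat -> R) (n : nat) :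
    (2 <= n)%N -> d 0%N = d 2%N ->
    (forall k, (3 <= k < 2 * n)%N -> d k = d (2 * n.+1 - k)%N) ->
  exists s, \prod_(0 <= k < 2 * n) d k = s ^+ 2 * (d 1%N * d n.+1).
Proof.
move=> n_ge2 d02 d_sym; exists (d 2%N * \prod_(3 <= k < n.+1) d k).
rewrite (@big_cat_nat _ _ _ 3) /=; [|lia..].
rewrite (@big_cat_nat _ _ _ n.+1 3) /=; [|lia..].
rewrite (@big_ltn _ _ _ n.+1); last by lia.
have -> : \prod_(n.+2 <= k < 2 * n) d k = \prod_(3 <= k < n.+1) d k.
  (* Shifting by n - 1 and then reversing the range replaces k by 2n + 2 - k. *)
  rewrite (_ : n.+2 = 3 + n.-1)%N; last by lia.
  rewrite big_addn big_nat_rev.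
  rewrite (_ : 2 * n - n.-1 = n.+1)%N; last by lia.
  rewrite big_nat_cond [RHS]big_nat_cond; apply: eq_bigr => k.
  rewrite andbT => lt_k; rewrite (d_sym k); last by lia.
  by congr d; lia.
rewrite big_ltn // big_ltn // big_ltn // big_geq // d02; ring.
Qed.

(* The hypothesis p <> 3 is necessary: for p = 3 one has det S_3 = -1, of
   Legendre symbol -1, whereas T_2 = 3 has Legendre symbol 0. *)
Theorem corollary1 (p : nat) (p_prime : prime p) (p_odd : odd p)
    (p_neq3 : p <> 3%N)
    (a : 'I_p.-1 -> 'F_p) (a_inj : injective a)
    (a_nonzero : forall x : 'F_p, (x \in codom a) = (x != 0)) :
  \det (S_mx a) != 0 ->
  quad_char (\det (S_mx a)) = legendre (central_trinomial (p.+1 %/ 2)) p.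
Proof.
pose n := p./2.
have p_gt1 := prime_gt1 p_prime.
have def_p1 : p.-1 = (2 * n)%N by rewrite /n; lia.
(* Here p is at least 5, so the central index n + 1 avoids the folded indices 0, 1, 2. *)
have n_ge2 : (2 <= n)%N by lia.
have oddF : odd #|'F_p| by rewrite card_Fp.
have halfF : #|'F_p|.-1./2 = n by rewrite card_Fp // /n; lia.
have a0 i : a i != 0 by rewrite -a_nonzero codom_f.
have aN i : a i ^+ p.-1 = 1.
  apply: (mulfI (a0 i)); rewrite -exprS mulr1 prednK; last by lia.
  by have := expf_card (a i); rewrite card_Fp.
pose c k := (trinomial 'F_p n.+1)`_k.
(* The degree 2n + 2 exceeds p - 1 = 2n by 2, so exactly the indices 2n, 2n + 1, 2n + 2 wrap
   around. *)
pose d k := c k + (if (k < 3)%N then c (k + 2 * n)%N else 0).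
have c_sym i j : (i + j = 2 * n.+1)%N -> c i = c j.
  exact: trinomial_coef_sym.
have sumE (z : 'F_p) : z ^+ p.-1 = 1 ->
    \sum_(k < (2 * n.+1).+1) c k * z ^+ k = \sum_(k < p.-1) d k * z ^+ k.
  rewrite def_p1 => zN.
  under [RHS]eq_bigr => k _ do rewrite mulrDl.
  rewrite big_split /= -!(big_mkord xpredT (fun k => c k * z ^+ k)).
  rewrite (@big_cat_nat _ _ _ (2 * n)) /=; [congr (_ + _)|lia..].
  rewrite -(big_mkord xpredT
    (fun k => (if (k < 3)%N then c (k + 2 * n)%N else 0) * z ^+ k)).
  rewrite [RHS](@big_cat_nat _ _ _ 3) /=; [|lia..].
  rewrite [X in _ = _ + X]big1_seq ?addr0; last first.
    move=> k /andP[_]; rewrite mem_index_iota => /andP[k_ge3 _].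
    by rewrite ltnNge k_ge3 mul0r.
  rewrite -[X in \big[_/_]_(X <= _ < _) _]add0n big_addn.
  rewrite (_ : (2 * n.+1).+1 - 2 * n = 3)%N; last by lia.
  by apply: eq_big_nat => k /= ->; rewrite exprD zN mulr1.
have S_E : S_mx a = \matrix_(i, j) (\sum_(k < p.-1) d k * (a i / a j) ^+ k)
    *m diag_mx (\row_j a j ^+ 2).
  apply/matrixP => i j; rewrite mul_mx_diag !mxE.
  (* An entry q χ(q) becomes q^(n+1), also when q = 0. *)
  rewrite (euler_criterion _ oddF) halfF -exprS trinomial_homog // -sumE.
    have -> : (2 * n.+1 = p.-1 + 2)%N by lia.
    by rewrite exprD aN mul1r mulrC.
  by rewrite exprMn exprVn !aN divff ?oner_neq0.
have d1 : d 1%N = 1.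
  rewrite /d /= (c_sym (1 + 2 * n)%N 1%N); last by lia.
  rewrite /c trinomial_coef1 -natrD.
  have -> : (n.+1 + n.+1 = p + 1)%N by lia.
  by rewrite natrD pchar_Fp_0 // add0r.
have dn : d n.+1 = (central_trinomial (p.+1 %/ 2))%:~R.
  have -> : (p.+1 %/ 2 = n.+1)%N by lia.
  rewrite /d ltnNge ltnS n_ge2 addr0 /c /trinomial /central_trinomial.
  by rewrite -coef_map rmorphXn !rmorphD /= rmorphXn /= map_polyX rmorph1.
have [s prod_d] : exists s, \prod_(k < p.-1) d k = s ^+ 2 * (d 1%N * d n.+1).
  rewrite def_p1 -(big_mkord xpredT d); apply: prod_sym_sqr => //.
    (* The symmetry exchanges 0 with 2n + 2 and 2 with 2n, so the two folded sums agree. *)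
    rewrite /d /= addrC; congr (_ + _); apply: c_sym; lia.
  move=> k k_bnd; rewrite /d !ifF; [|lia..].
  by rewrite !addr0; apply: c_sym; lia.
rewrite S_E det_mulmx det_ratio_mx // det_diag prod_d d1 mul1r dn.
under eq_bigr => j _ do rewrite mxE.
rewrite prodrXl; set v := \prod_(j < _) _; set t := _%:~R.
(* The exponent p - 1 = 2n is even, so this factor is a square too. *)
pose u : 'F_p := p.-1%:R ^+ n; rewrite (_ : _ ^+ p.-1 = u ^+ 2); last first.
  by rewrite -exprM mulnC -def_p1.
have -> : u ^+ 2 * (s ^+ 2 * t) * v ^+ 2 = (u * s * v) ^+ 2 * t by ring.
move=> det_neq0; apply: quad_char_sqrM; apply: contraNneq det_neq0 => ->.
by rewrite expr0n mul0r.
Qed.
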